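(* Let $\mathbb{F}_q$ be a finite field with $q$ elements and let $n$ be a positive integer. Let $\alpha, \beta, \gamma \in \mathbb{F}_q$ satisfy $\alpha + \beta + \gamma = 0$ and $\gamma \neq 0$. Let $A$ be a subset of $\mathbb{F}_q^n$ such that the equation $$\alpha a_1 + \beta a_2 + \gamma a_3 = 0$$ has no solutions $(a_1,a_2,a_3) \in A^3$ apart from those with $a_1=a_2=a_3$. Then $$|A| \leq 3\, m_{(q-1)n/3},$$ where, for a real number $d$, $m_d$ denotes the number of monomials in $x_1,\ldots,x_n$ with total degree at most $d$ in which each variable appears with degree at most $q-1$.
   Context: For fixed $q$ and $n$ and a real number $d \ge 0$, $m_d$ is the number of tuples $(e_1,\ldots,e_n)$ of integers with $0 \le e_i \le q-1$ for all $i$ and $e_1+\cdots+e_n \le d$ (the exponent tuples of the monomials $x_1^{e_1}\cdots x_n^{e_n}$). The index $d=(q-1)n/3$ is a real number and need not be an integer. *)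

(* Defs.v *)
From HB Require Import structures.
From mathcomp Require Import all_boot all_order all_algebra.
From mathcomp Require Import reals.

Set Implicit Arguments.
Unset Strict Implicit.
Unset Printing Implicit Defensive.

Import Order.TTheory GRing.Theory Num.Theory.

Local Open Scope ring_scope.

(* m_d: the monomial x_1^{e_1} ... x_n^{e_n} with 0 <= e_i <= q - 1 is encoded
   by its exponent tuple e : {ffun 'I_n -> 'I_q}. *)
Definition num_monomials (R : realType) (q n : nat) (d : R) : nat :=
  #|[set e : {ffun 'I_n -> 'I_q} | (\sum_(i < n) e i)%N%:R <= d]|.

(* Main.v *)
(** A trilinear form on functions on [A] that is diagonal with entry 1 has slice
    rank [#|A|].  By hypothesis the indicator of
    [alpha *: x + beta *: y + gamma *: z = 0] restricted to [A] is such a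
    diagonal tensor.  As a polynomial this indicator is
    [\prod_i (1 - (alpha x_i + beta y_i + gamma z_i) ^ (q - 1))], of total degree
    [(q - 1) n]; so in each of its monomials the part in [x], in [y] or in [z]
    has degree at most [(q - 1) n / 3], which writes the tensor as a sum of
    [3 m_{(q-1)n/3}] slices. *)
Require Import Defs.
From HB Require Import structures.
From mathcomp Require Import all_boot all_order all_algebra all_field.
From mathcomp Require Import reals ring zify.

Set Implicit Arguments.
Unset Strict Implicit.
Unset Printing Implicit Defensive.

Import Order.TTheory GRing.Theory Num.Theory.

Local Open Scope ring_scope.

(** Terms sharing the same [p t] share their column, so each such group collapses to one outer
    product, of rank at most 1. *)
Lemma mxrank_sum_outer_le (F : fieldType) (m k : nat) (I T : finType)
    (S : {set I}) (P : pred T) (p : T -> I) (u : I -> 'cV[F]_m)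
    (v : T -> 'rV[F]_k) :
  (forall t, P t -> p t \in S) ->
  (\rank (\sum_(t | P t) u (p t) *m v t)%R <= #|S|)%N.
Proof.
move=> PS; rewrite (partition_big p (mem S)) //=.
rewrite (eq_bigr (fun s => u s *m \sum_(t | P t && (p t == s)) v t)); last first.
  by move=> s _; rewrite mulmx_sumr; apply: eq_bigr => t /andP[_ /eqP->].
rewrite -sum1_card.
elim/big_ind2: _ => [|M1 n1 M2 n2 h1 h2|s _]; first by rewrite mxrank0.
  exact: leq_trans (mxrank_add _ _) (leq_add h1 h2).
exact: leq_trans (mxrankM_maxr _ _) (rank_leq_row _).
Qed.

Lemma submx_ones (F : fieldType) (m k : nat) (K : 'M[F]_(m, k)) :
  exists2 h : 'rV[F]_k, (h <= K)%MS &
    exists2 g : 'I_(\rank K) -> 'I_k, injective g & forall i, h 0 (g i) = 1.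
Proof.
have rk : row_full (row_base K)^T by rewrite /row_full mxrank_tr eq_row_base.
(* [g] selects columns of [row_base K] forming an invertible minor, so the coordinates there can be
   prescribed freely. *)
pose g := fullrankfun rk; pose M := rowsub g (row_base K)^T.
have Mu : M^T \in unitmx by rewrite unitmx_tr fullrowsub_unit.
have MtE : M^T = colsub g (row_base K) by apply/matrixP => i j; rewrite !mxE.
pose w : 'rV[F]_(\rank K) := const_mx 1 *m invmx M^T.
exists (w *m row_base K).
  by apply: submx_trans (submxMl _ _) _; rewrite eq_row_base.
exists g => [|i]; first exact: fullrankfun_inj.
have : colsub g (w *m row_base K) = const_mx 1.
  by rewrite -mulmx_colsub -MtE mulmxKV.
by move/matrixP/(_ 0 i); rewrite !mxE.
Qed.

Lemma mxrank_diag_ge (F : fieldType) (r k : nat) (h : 'rV[F]_k)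
    (g : 'I_r -> 'I_k) :
  injective g -> (forall i, h 0 (g i) = 1) -> (r <= \rank (diag_mx h))%N.
Proof.
move=> ginj hg.
have <- : \rank (mxsub g g (diag_mx h)) = r.
  rewrite -[RHS](mxrank1 F); congr (\rank _); apply/matrixP => i j.
  by rewrite !mxE (inj_eq ginj) hg.
rewrite -[diag_mx h in X in (X <= _)%N]mulmx1 mxsub_mul rowsubE.
exact: leq_trans (mxrankM_maxl _ _) (mxrankM_maxr _ _).
Qed.

(** Contracting [z] with a vector [h] orthogonal to every [f s], [s \in S], leaves [diag_mx h]. Its
    rank is at least [k - #|S|] for a suitable [h], and at most [2 * #|S|] since only slices in [x]
    or [y] survive. *)
Lemma diag_tensor_slice_rank (F : fieldType) (k : nat) (I T : finType)
    (S : {set I}) (f : I -> 'I_k -> F) (c : T -> F) (p1 p2 p3 : T -> I) :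
  (forall t, c t != 0 -> [|| p1 t \in S, p2 t \in S | p3 t \in S]) ->
  (forall x y z, \sum_t c t * f (p1 t) x * f (p2 t) y * f (p3 t) z
     = ((x == y) && (y == z))%:R) ->
  (k <= 3 * #|S|)%N.
Proof.
move=> cS diagT.
pose F3 : 'M[F]_(k, #|S|) := \matrix_(z, j) f (enum_val j) z.
have [h hK [g ginj hg]] := submx_ones (kermx F3).
have h0 s : s \in S -> \sum_z h 0 z * f s z = 0.
  move=> sS; move/sub_kermxP/matrixP/(_ 0 (enum_rank_in sS s)): hK.
  rewrite !mxE => hK0; rewrite -[RHS]hK0; apply: eq_bigr => z _.
  by rewrite !mxE enum_rankK_in.
have := mxrank_diag_ge ginj hg; rewrite mxrank_ker.
pose C i : 'cV[F]_k := \col_x f i x.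
pose w t := c t * \sum_z h 0 z * f (p3 t) z.
(* Contracting the tensor with [h] kills every term with [p3 t \in S]. *)
have DE : diag_mx h = \sum_t w t *: (C (p1 t) *m (C (p2 t))^T).
  apply/matrixP => x y; rewrite summxE.
  transitivity (\sum_z h 0 z * ((x == y) && (y == z))%:R).
    rewrite mxE (bigD1 y) //= eqxx andbT big1 ?addr0 => [|z].
      by case: eqP => [->|_]; rewrite ?mulr1 ?mulr0.
    by rewrite eq_sym => /negPf->; rewrite andbF mulr0.
  under eq_bigr => z _ do rewrite -diagT mulr_sumr.
  rewrite exchange_big; apply: eq_bigr => t _ /=.
  rewrite !mxE big_ord1 !mxE /w mulr_sumr mulr_suml.
  by apply: eq_bigr => z _; ring.
have {DE} rkD : (\rank (diag_mx h) <= #|S| + #|S|)%N.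
  rewrite DE (bigID (fun t => p1 t \in S)) /=.
  rewrite [X in (_ + X)%R](bigID (fun t => p2 t \in S)) /=.
  rewrite [X in (_ + (_ + X))%R]big1 ?addr0 => [|t /andP[/negPf n1 /negPf n2]].
    apply: leq_trans (mxrank_add _ _) (leq_add _ _).
      under eq_bigr => t _ do rewrite scalemxAr.
      exact: (mxrank_sum_outer_le C).
    (* Transposing moves the factor indexed by [p2] to the left, so the same rank bound applies. *)
    rewrite -mxrank_tr raddf_sum /=.
    under eq_bigr => t _ do rewrite linearZ /= trmx_mul trmxK scalemxAr.
    by apply: (mxrank_sum_outer_le C) => t /andP[].
  rewrite /w; have [->|/cS] := eqVneq (c t) 0; first by rewrite mul0r scale0r.
  by rewrite n1 n2 => /h0->; rewrite mulr0 scale0r.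
move=> /leq_trans/(_ rkD); have := rank_leq_col F3; lia.
Qed.

Lemma one_sub_linear_exp_expansion (F : fieldType) (N : nat) (a b c : F) :
  exists (T : finType) (k : T -> F) (e1 e2 e3 : T -> 'I_N.+1),
  (forall t, k t != 0 -> (e1 t + e2 t + e3 t <= N)%N) /\
  (forall x y z, 1 - (a * x + b * y + c * z) ^+ N
     = \sum_t k t * x ^+ e1 t * y ^+ e2 t * z ^+ e3 t).
Proof.
pose T : finType := ('I_1 + 'I_N.+1 * 'I_N.+1)%type.
(* The left summand of [T] carries the constant 1; [inr (i, j)] carries the term with [z ^+ i] and
   [y ^+ j]. If [i + j] exceeds [N], the subtraction truncates, but ['C(N - i, j)] is then 0. *)
pose e1 (t : T) : 'I_N.+1 := if t is inr p then inord (N - p.1 - p.2) else ord0.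
pose e2 (t : T) : 'I_N.+1 := if t is inr p then p.2 else ord0.
pose e3 (t : T) : 'I_N.+1 := if t is inr p then p.1 else ord0.
pose k (t : T) : F := if t is inr p then
  - (a ^+ (N - p.1 - p.2) * b ^+ p.2 * c ^+ p.1 *+ 'C(N - p.1, p.2) *+ 'C(N, p.1))
  else 1.
have e1E i j : e1 (inr (i, j)) = (N - i - j)%N :> nat.
  by rewrite /= inordK // ltnS -subnDA leq_subr.
exists T, k, e1, e2, e3; split=> [[//|[i j]]|x y z].
  rewrite e1E /=; case: (leqP j (N - i)) => ij; first by have := ltn_ord i; lia.
  by rewrite bin_small // mulr0n mul0rn oppr0 eqxx.
rewrite big_sumType big_ord1 /= !expr0 !mulr1; congr (_ + _).
rewrite exprDn -sumrN.
rewrite -(pair_bigA _ (fun i j => k (inr (i, j)) * x ^+ e1 (inr (i, j))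
  * y ^+ j * z ^+ i)) /=.
apply: eq_bigr => i _; rewrite exprDn.
rewrite (big_ord_widen N.+1 (fun j => (a * x) ^+ (N - i - j) * (b * y) ^+ j
  *+ 'C(N - i, j))) ?ltnS ?leq_subr //.
rewrite big_mkcond mulr_suml -sumrMnl -sumrN; apply: eq_bigr => j _.
rewrite -/(e1 (inr (i, j))) e1E /= ltnS; case: leqP => ij; last first.
  by rewrite (bin_small ij) mulr0n mul0r mul0rn oppr0 !mul0r.
rewrite !exprMn; ring.
Qed.

Lemma one_sub_expf_card (F : finFieldType) (N : nat) (u : F) :
  #|F| = N.+1 -> 1 - u ^+ N = (u == 0)%:R.
Proof.
move=> cF; have := finNzRing_gt1 F; rewrite cF ltnS => N0.
have [->|u0] := eqVneq u 0; first by rewrite expr0n gtn_eqF // subr0.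
have := expf_card u; rewrite cF exprS -[RHS]mulr1 => /(mulfI u0)->.
by rewrite subrr.
Qed.

Lemma natr_le_third (R : realType) (a b c m : nat) :
  (a + b + c <= m)%N ->
  [|| a%:R <= m%:R / 3%:R :> R, b%:R <= m%:R / 3%:R :> R
    | c%:R <= m%:R / 3%:R :> R].
Proof. by move=> h; rewrite !ler_pdivlMr ?ltr0n // -!natrM !ler_nat; lia. Qed.

Theorem theorem4 (R : realType) (F : finFieldType) (n : nat) (hn : (0 < n)%N)
    (alpha beta gamma : F)
    (hsum : alpha + beta + gamma = 0) (hgamma : gamma != 0)
    (A : {set 'rV[F]_n})
    (hA : forall a1 a2 a3 : 'rV[F]_n,
        a1 \in A -> a2 \in A -> a3 \in A ->
        alpha *: a1 + beta *: a2 + gamma *: a3 = 0 ->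
        a1 = a2 /\ a2 = a3) :
  (#|A| <= 3 * num_monomials #|F| n ((#|F|%:R - 1) * n%:R / 3%:R : R))%N.
Proof.
have [N cF] : exists N, #|F| = N.+1.
  by exists #|F|.-1; rewrite prednK // (ltnW (finNzRing_gt1 F)).
rewrite cF -natr1 addrK -natrM /num_monomials; set S := [set e | _].
have [T [k [e1 [e2 [e3 [kN kE]]]]]] :=
  one_sub_linear_exp_expansion N alpha beta gamma.
pose mon (e : {ffun 'I_n -> 'I_N.+1}) (x : 'I_#|A|) : F :=
  \prod_i (enum_val x) 0 i ^+ e i.
(* Expanding the product over coordinates chooses one term [t i] for each [i]; [p e1 t], [p e2 t],
   [p e3 t] are the resulting exponent tuples and [c t] the coefficient. *)
pose p (d : T -> 'I_N.+1) (t : {ffun 'I_n -> T}) : {ffun 'I_n -> 'I_N.+1} :=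
  [ffun i => d (t i)].
pose c (t : {ffun 'I_n -> T}) : F := \prod_i k (t i).
apply: (@diag_tensor_slice_rank F #|A| _ _ S mon c (p e1) (p e2) (p e3))
  => [t /prodf_neq0 kt0|x y z].
  (* As [c t] is nonzero, so is every [k (t i)]; the degree bound [N] per coordinate sums to
     [N * n]. *)
  rewrite !inE; apply: natr_le_third.
  have -> : (N * n = \sum_(i < n) N)%N by rewrite sum_nat_const card_ord mulnC.
  rewrite -!big_split /=.
  by apply: leq_sum => i _; rewrite !ffunE kN ?kt0.
transitivity (\prod_(i < n) (1 - (alpha * (enum_val x) 0 i
    + beta * (enum_val y) 0 i + gamma * (enum_val z) 0 i) ^+ N)).
  under [RHS]eq_bigr => i _ do rewrite kE.
  rewrite bigA_distr_bigA; apply: eq_bigr => t _.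
  rewrite /mon -!big_split /=.
  by apply: eq_bigr => i _; rewrite !ffunE.
under eq_bigr => i _ do rewrite (one_sub_expf_card _ cF).
case: (boolP ((x == y) && (y == z))) => [/andP[/eqP-> /eqP->]|xyz].
  by apply: big1 => i _; rewrite -!mulrDl hsum mul0r eqxx.
(* If no factor vanishes, the linear form is 0 in every coordinate, and [hA] forces [x = y = z]. *)
apply/eqP/prodf_eq0; apply/exists_inP; apply: contraNT xyz => /exists_inPn h.
have [||||xy yz] := hA (enum_val x) (enum_val y) (enum_val z).
- exact: enum_valP.
- exact: enum_valP.
- exact: enum_valP.
- apply/rowP => i; rewrite !mxE; have := h i isT.
  by apply: contraNeq => /negPf->.
by rewrite (enum_val_inj xy) (enum_val_inj yz) !eqxx.
Qed.
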